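(* Let $N\ge 1$ be an integer, $h=1/N$, let $\beta_x,\beta_y\in\mathbb{R}$ and $\epsilon>0$ be constants, let $f\in D_{0,h}$, and let $$b(u,v)=(\beta_x\nabla_{x+}u+\beta_y\nabla_{y+}u,\,v)_h+\epsilon\,(u,v)_{\nabla,h},\qquad l(v)=(f,v)_h,\qquad u,v\in D_{0,h}.$$ Let $\mu>0$ and $\alpha>0$ be boundedness and coercivity constants of $b$, i.e. $b(u,v)\le\mu\|u\|_{\nabla,h}\|v\|_{\nabla,h}$ for all $u,v\in D_{0,h}$ and $b(u,u)\ge\alpha\|u\|_{\nabla,h}^2$ for all $u\in D_{0,h}$. Let $u_{\mathrm{EXACT}}\in D_{0,h}$ be the unique solution of $b(u_{\mathrm{EXACT}},v)=l(v)$ for all $v\in D_{0,h}$. For $u\in D_{0,h}$ let $r(u)\in D_{0,h}$ be its residual representative, i.e. the unique element of $D_{0,h}$ such that $(r(u),v)_{\nabla,h}=b(u,v)-l(v)$ for all $v\in D_{0,h}$. Then for every $u\in D_{0,h}$, $$\frac1\mu\|r(u)\|_{\nabla,h}\le\|u-u_{\mathrm{EXACT}}\|_{\nabla,h}\le\frac1\alpha\|r(u)\|_{\nabla,h}.$$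
   Context: Let $N\ge1$ be an integer and $h=1/N$. The grid is $\Omega_h=\{(ih,jh):0\le i,j\le N\}\subset[0,1]^2$. $D_h$ is the real vector space of functions $u:\Omega_h\to\mathbb{R}$, with the notation $u_{i,j}=u(ih,jh)$, and $D_{0,h}\subset D_h$ is the subspace of functions vanishing at all boundary grid points (those with $i\in\{0,N\}$ or $j\in\{0,N\}$). The discrete inner product is $(u,v)_h=h^2\sum_{p\in\Omega_h}u(p)v(p)$, with $\|u\|_h^2=(u,u)_h$. The forward differences are $\nabla_{x+}u_{i,j}=(u_{i+1,j}-u_{i,j})/h$ and $\nabla_{y+}u_{i,j}=(u_{i,j+1}-u_{i,j})/h$. For $u\in D_{0,h}$, $u$ is extended by zero outside the grid, so that these differences are defined on all of $\Omega_h$. For $u,v\in D_{0,h}$, $(u,v)_{\nabla,h}=(\nabla_{x+}u,\nabla_{x+}v)_h+(\nabla_{y+}u,\nabla_{y+}v)_h$ and $\|u\|_{\nabla,h}^2=(u,u)_{\nabla,h}$. *)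

(* Defs.v *)
From HB Require Import structures.
From mathcomp Require Import all_boot all_order all_algebra.
From mathcomp Require Import reals.

Set Implicit Arguments.
Unset Strict Implicit.
Unset Printing Implicit Defensive.

Import Order.TTheory GRing.Theory Num.Theory.

Local Open Scope ring_scope.

(* The grid point (i h, j h), h = 1/N, is represented by its index (i, j). *)
Definition grid (N : nat) : finType := ('I_N.+1 * 'I_N.+1)%type.

(* D_h; the regular module R^o as codomain makes it a vector space over R. *)
Definition gridfun (R : realType) (N : nat) := {ffun grid N -> R^o}.

Section Grid.
Variables (R : realType) (N : nat).
Implicit Types (u v f : gridfun R N) (p : grid N).

Definition mesh : R := N%:R^-1.

Definition boundary p : bool :=
  [|| p.1 == 0 :> nat, p.1 == N :> nat, p.2 == 0 :> nat | p.2 == N :> nat].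

(* D_{0,h} *)
Definition D0 : {pred gridfun R N} :=
  [pred u : gridfun R N | [forall p, boundary p ==> (u p == 0)]].

Lemma D0_submod_closed : submod_closed D0.
Proof.
split=> [|a u v /forallP u0 /forallP v0]; apply/forallP => p; apply/implyP => bp.
  by rewrite ffunE.
have /eqP up := implyP (u0 p) bp; have /eqP vp := implyP (v0 p) bp.
by rewrite !ffunE up vp scaler0 addr0.
Qed.

HB.instance Definition _ :=
  GRing.isSubmodClosed.Build R (gridfun R N) D0 D0_submod_closed.

Definition dotp u v : R := mesh ^+ 2 * \sum_p u p * v p.

(* Extension by zero. Natural-number indices suffice, because only forward
   differences at grid points are taken. *)
Definition ext0 u (i j : nat) : R :=
  if (insub i, insub j) is (Some i', Some j') then u (i', j') else 0.

Definition dxp u : gridfun R N :=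
  [ffun p : grid N => (ext0 u p.1.+1 p.2 - ext0 u p.1 p.2) / mesh].

Definition dyp u : gridfun R N :=
  [ffun p : grid N => (ext0 u p.1 p.2.+1 - ext0 u p.1 p.2) / mesh].

Definition nabladotp u v : R := dotp (dxp u) (dxp v) + dotp (dyp u) (dyp v).

Definition nablanorm u : R := Num.sqrt (nabladotp u u).

Definition bform (betax betay eps : R) u v : R :=
  dotp (betax *: dxp u + betay *: dyp u) v + eps * nabladotp u v.

Definition lform f v : R := dotp f v.

Definition is_solution (betax betay eps : R) f (uex : gridfun R N) : Prop :=
  uex \in D0 /\
  forall v, v \in D0 -> bform betax betay eps uex v = lform f v.

Definition is_residual (betax betay eps : R) f u (r : gridfun R N) : Prop :=
  r \in D0 /\
  forall v, v \in D0 -> nabladotp r v = bform betax betay eps u v - lform f v.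

End Grid.

Arguments D0 : clear implicits.

(* Main.v *)
(** On the finite-dimensional space [D0] both [bform] (by coercivity) and
    [nabladotp] (a grid function vanishing at the left edge with vanishing
    horizontal differences is zero) are bilinear and definite, so each
    represents every linear functional uniquely.  With [e = u - uex] the
    residual satisfies [(r, v) = b (e, v)] on [D0]; taking [v = r] gives the
    lower bound, and [v = e] with Cauchy-Schwarz the upper one. *)
Require Import Defs.
From HB Require Import structures.
From mathcomp Require Import all_boot all_order all_algebra.
From mathcomp Require Import reals ring.

Import Order.TTheory GRing.Theory Num.Theory.

Local Open Scope ring_scope.

(** * Definite bilinear forms on abstract vector spaces *)

Lemma scalarB {K : pzRingType} {V : lmodType K} {f : V -> K} :
  scalar f -> forall u v, f (u - v) = f u - f v.
Proof. by move=> lf u v; rewrite addrC -scaleN1r lf mulN1r addrC. Qed.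

(** Finite-dimensional Lax-Milgram: definiteness makes [u] to [a u] injective from [U] to its dual,
    and equal dimensions make it onto. *)
Lemma definite_form_represents {K : fieldType} {V : vectType K}
    (U : {vspace V}) (a : V -> V -> K) (l : V -> K) :
  (forall v, scalar (a^~ v)) -> (forall u, scalar (a u)) -> scalar l ->
  (forall u, u \in U -> a u u = 0 -> u = 0) ->
  exists! u, u \in U /\ forall v, v \in U -> a u v = l v.
Proof.
move=> al ar ll a_def; set b := vbasis U.
have freeb : free b := basis_free (vbasisP U).
(* [S] encodes a functional on [U] by a vector of [U] with its basis values as coordinates, so that
   dimension counting applies to an endomorphism. *)
pose S (f : V -> K) := \sum_(i < \dim U) f b`_i *: b`_i.
have S_inj (f g : V -> K) : scalar f -> scalar g -> S f = S g ->
    forall v, v \in U -> f v = g v.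
  move=> lf lg fg v /coord_vbasis ->.
  pose F : {scalar V} := HB.pack f (GRing.isLinear.Build _ _ _ _ _ lf).
  pose G : {scalar V} := HB.pack g (GRing.isLinear.Build _ _ _ _ _ lg).
  rewrite -[f]/(F : _ -> _) -[g]/(G : _ -> _) !linear_sum.
  apply: eq_bigr => i _; rewrite !linearZ /=; congr (_ * _).
  by have := congr1 (coord b i) fg; rewrite !coord_sum_free.
have S_in f : S f \in U.
  by apply: memv_suml => i _; rewrite memvZ ?vbasis_mem ?mem_nth ?size_tuple.
pose T u := S (a u).
have lT : linear T.
  move=> k u v; rewrite /T /S scaler_sumr -big_split; apply: eq_bigr => i _ /=.
  by rewrite al scalerDl scalerA.
pose TL : {linear V -> V} := HB.pack T (GRing.isLinear.Build _ _ _ _ _ lT).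
have TE u : linfun TL u = S (a u) by rewrite lfunE.
have l0 : scalar (fun _ : V => 0 : K) by move=> k u v /=; rewrite mulr0 addr0.
(* If [S (a u) = 0] then [a u] vanishes on [U], in particular at [u] itself. *)
have kerT : (U :&: lker (linfun TL) = 0)%VS.
  apply/eqP; rewrite -subv0; apply/subvP => u; rewrite memv_cap memv_ker TE.
  case/andP=> uU /eqP Tu0; rewrite memv0; apply/eqP/a_def => //.
  apply: (S_inj (a u) _ (ar u) l0) => //.
  by rewrite Tu0 /S big1 // => i _; rewrite scale0r.
have imT : (linfun TL @: U = U)%VS.
  apply/eqP; rewrite eqEdim (limg_dim_eq kerT) leqnn andbT.
  by apply/subvP => _ /memv_imgP[u _ ->]; rewrite TE.
have : S l \in (linfun TL @: U)%VS by rewrite imT.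
case/memv_imgP=> u uU; rewrite TE => Su.
exists u; split; first by split=> //; apply: (S_inj _ _ (ar u) ll (esym Su)).
(* Two representatives of [l] differ by a vector on which the form vanishes. *)
move=> w [wU aw]; apply/eqP; rewrite -subr_eq0; apply/eqP.
have uwU : u - w \in U by rewrite memvB.
apply: a_def => //; rewrite (scalarB (al _)) aw //.
by rewrite (S_inj _ _ (ar u) ll (esym Su)) // subrr.
Qed.

(** Definiteness is asked at [u] alone, so that the bound applies to a form shown to be definite
    only on a subspace containing [u]. *)
Lemma Cauchy_Schwarz {R : rcfType} {V : lmodType R} (a : V -> V -> R) (u v : V) :
  (forall w, scalar (a^~ w)) -> (forall w, scalar (a w)) ->
  (forall w z, a w z = a z w) -> (forall w, 0 <= a w w) ->
  (a u u = 0 -> u = 0) -> a u v <= Num.sqrt (a u u) * Num.sqrt (a v v).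
Proof.
move=> al ar aC a_ge0 a_def.
have := sqr_sqrtr (a_ge0 u); have := sqr_sqrtr (a_ge0 v).
have := sqrtr_ge0 (a v v); have := sqrtr_ge0 (a u u).
set x := Num.sqrt (a u u); set y := Num.sqrt (a v v) => x0 y0 yE xE.
have [x_eq0|xn0] := eqVneq x 0.
  rewrite x_eq0 mul0r a_def; last by rewrite -xE x_eq0 expr0n.
  by have := scalarB (al v) 0 0; rewrite !subrr => ->.
have {x0 xn0} x0 : 0 < x by rewrite lt_def xn0.
have aDl k w z t : a (k *: w + z) t = k * a w t + a z t := al t k w z.
have aDr k w z t : a t (k *: w + z) = k * a t w + a t z := ar t k w z.
(* The component of [v] orthogonal to [u] has nonnegative square. *)
have := a_ge0 (- (a u v / x ^+ 2) *: u + v).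
rewrite !aDl !aDr (aC v u) -yE -xE; set c := a u v => h.
have : c ^+ 2 <= (x * y) ^+ 2.
  rewrite exprMn mulrC -ler_pdivrMr ?exprn_gt0 //.
  (* The expanded square in [h] equals [y ^+ 2 - c ^+ 2 / x ^+ 2]. *)
  rewrite -subr_ge0; apply: le_trans h _; rewrite le_eqVlt; apply/orP; left.
  by apply/eqP; field; rewrite gt_eqF.
move=> le2; apply: le_trans (ler_norm c) _.
by rewrite -ler_sqr ?nnegrE ?mulr_ge0 ?normr_ge0 ?(ltW x0) // real_normK ?num_real.
Qed.

(** * Bilinearity and definiteness of the discrete forms *)

Section GridForms.
Context {R : realType} {N : nat}.
Implicit Types (u v w : gridfun R N).

Lemma ext0_linear (k : R) u v i j :
  ext0 (k *: u + v) i j = k * ext0 u i j + ext0 v i j.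
Proof.
rewrite /ext0; case: insub => [i'|]; last by rewrite mulr0 addr0.
by case: insub => [j'|]; rewrite ?mulr0 ?addr0 // !ffunE.
Qed.

Lemma dxp_linear : linear (@dxp R N).
Proof.
move=> k u v; apply/ffunP => p.
by rewrite !ffunE !ext0_linear /GRing.scale /=; ring.
Qed.

Lemma dyp_linear : linear (@dyp R N).
Proof.
move=> k u v; apply/ffunP => p.
by rewrite !ffunE !ext0_linear /GRing.scale /=; ring.
Qed.

Lemma dotpC u v : dotp u v = dotp v u.
Proof. by congr (_ * _); apply: eq_bigr => p _; rewrite mulrC. Qed.

Lemma dotp_linear_r u : scalar (dotp u).
Proof.
move=> k v w; rewrite /dotp mulrCA -mulrDr; congr (_ * _).
rewrite mulr_sumr -big_split; apply: eq_bigr => p _ /=.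
by rewrite !ffunE /GRing.scale /=; ring.
Qed.

Lemma dotp_linear_l v : scalar ((@dotp R N)^~ v).
Proof. by move=> k u w; rewrite /= !(dotpC _ v) dotp_linear_r. Qed.

Lemma dotp_ge0 u : 0 <= dotp u u.
Proof.
by rewrite mulr_ge0 ?sqr_ge0 // sumr_ge0 // => p _; rewrite -expr2 sqr_ge0.
Qed.

(** Positivity of [N] keeps the weight [mesh ^+ 2] nonzero; at [N = 0] the convention [0^-1 = 0]
    makes the form vanish identically. *)
Lemma dotp_eq0 u : (0 < N)%N -> dotp u u = 0 -> u = 0.
Proof.
move=> N0 /eqP.
rewrite mulf_eq0 expf_eq0 invr_eq0 pnatr_eq0 -[N == 0]negbK -lt0n N0 /=.
rewrite psumr_eq0 => [/allP u0|p _]; last by rewrite -expr2 sqr_ge0.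
apply/ffunP => p; have := u0 p (mem_index_enum p).
by rewrite ffunE mulf_eq0 orbb => /eqP.
Qed.

Lemma nabladotpC u v : nabladotp u v = nabladotp v u.
Proof. by rewrite /nabladotp dotpC [in X in _ + X]dotpC. Qed.

Lemma nabladotp_linear_r u : scalar (nabladotp u).
Proof.
move=> k v w.
by rewrite /nabladotp dxp_linear dyp_linear !dotp_linear_r; ring.
Qed.

Lemma nabladotp_linear_l v : scalar ((@nabladotp R N)^~ v).
Proof. by move=> k u w; rewrite /= !(nabladotpC _ v) nabladotp_linear_r. Qed.

Lemma nabladotp_ge0 u : 0 <= nabladotp u u.
Proof. by rewrite addr_ge0 ?dotp_ge0. Qed.

Lemma nablanorm_sqr u : nablanorm u ^+ 2 = nabladotp u u.
Proof. by rewrite sqr_sqrtr ?nabladotp_ge0. Qed.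

Lemma nabladotp_eq0 u :
  (0 < N)%N -> u \in D0 R N -> nabladotp u u = 0 -> u = 0.
Proof.
move=> N0 /forallP uD /eqP; rewrite paddr_eq0 ?dotp_ge0 // => /andP[/eqP dx0 _].
move/(dotp_eq0 _ N0)/ffunP: dx0 => dx0.
have ext0E (i j : 'I_N.+1) : ext0 u i j = u (i, j) by rewrite /ext0 !valK.
suff u0 i (j : 'I_N.+1) : (i < N.+1)%N -> ext0 u i j = 0.
  by apply/ffunP => -[i j]; rewrite -ext0E u0 // ffunE.
(* Induction on the column: the boundary condition gives column 0, and a zero difference at column
   [i] carries the value 0 to column [i.+1]. *)
elim: i => [|i IHi] lti.
  have /implyP/(_ isT)/eqP := uD (ord0, j).
  by rewrite -ext0E.
have /eqP := dx0 (Ordinal (ltnW lti), j); rewrite !ffunE /= IHi 1?ltnW // subr0.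
by rewrite mulf_eq0 !invr_eq0 pnatr_eq0 -[N == 0]negbK -lt0n N0 orbF => /eqP.
Qed.

Lemma bform_linear_l betax betay eps v :
  scalar ((@bform R N betax betay eps)^~ v).
Proof.
move=> k u w; rewrite /bform nabladotp_linear_l dxp_linear dyp_linear.
have dotpD s t : dotp (s + t) v = dotp s v + dotp t v.
  by rewrite -[s]scale1r dotp_linear_l mul1r scale1r.
have dotpZ c s : dotp (c *: s) v = c * dotp s v.
  have dotp0 : dotp (0 : gridfun R N) v = 0.
    by have := scalarB (dotp_linear_l v) 0 0; rewrite !subrr.
  by rewrite -[c *: s]addr0 dotp_linear_l dotp0 addr0.
by rewrite !(dotpD, dotpZ); ring.
Qed.

Lemma bform_linear_r betax betay eps u : scalar (@bform R N betax betay eps u).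
Proof. by move=> k v w; rewrite /bform nabladotp_linear_r dotp_linear_r; ring. Qed.

(** Its kernel is [D0], which turns that predicate into a [{vspace}] to which the representation
    lemma applies. *)
Definition boundary_restriction u : gridfun R N :=
  [ffun p => if boundary p then u p else 0].

Lemma boundary_restriction_linear : linear boundary_restriction.
Proof.
move=> k u v; apply/ffunP => p; rewrite !ffunE.
by case: ifP; rewrite ?scaler0 ?addr0.
Qed.

Lemma D0_vspace : exists U : {vspace gridfun R N}, U =i D0 R N.
Proof.
pose B : {linear gridfun R N -> gridfun R N} := HB.pack boundary_restriction
  (GRing.isLinear.Build _ _ _ _ _ boundary_restriction_linear).
exists (lker (linfun B)) => u; rewrite memv_ker lfunE /=.
apply/eqP/forallP => [/ffunP u0 p|u0].
  by apply/implyP => bp; have := u0 p; rewrite !ffunE bp => ->.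
apply/ffunP => p; rewrite !ffunE; case: ifP => // bp.
exact/eqP/(implyP (u0 p)).
Qed.

Lemma definite_form_represents_D0 (a : gridfun R N -> gridfun R N -> R)
    (l : gridfun R N -> R) :
  (forall v, scalar (a^~ v)) -> (forall u, scalar (a u)) -> scalar l ->
  (forall u, u \in D0 R N -> a u u = 0 -> u = 0) ->
  exists! u, u \in D0 R N /\ forall v, v \in D0 R N -> a u v = l v.
Proof.
move=> al ar ll a_def; have [U UE] := D0_vspace.
have [|u [[uU au] u_uniq]] := definite_form_represents U a l al ar ll.
  by move=> u; rewrite UE; apply: a_def.
exists u; split; first by split=> [|v]; rewrite -UE //; apply: au.
by move=> w [wU aw]; apply: u_uniq; split=> [|v]; rewrite UE //; apply: aw.
Qed.

End GridForms.

Theorem theorem1 (R : realType) (N : nat) (hN : (1 <= N)%N)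
    (betax betay eps : R) (heps : 0 < eps)
    (f : gridfun R N) (hf : f \in D0 R N)
    (mu alpha : R) (hmu : 0 < mu) (halpha : 0 < alpha)
    (hbounded : forall u v : gridfun R N, u \in D0 R N -> v \in D0 R N ->
       bform betax betay eps u v <= mu * nablanorm u * nablanorm v)
    (hcoercive : forall u : gridfun R N, u \in D0 R N ->
       alpha * nablanorm u ^+ 2 <= bform betax betay eps u u) :
  (exists! uex : gridfun R N, is_solution betax betay eps f uex) /\
  (forall u : gridfun R N, u \in D0 R N ->
     exists! r : gridfun R N, is_residual betax betay eps f u r) /\
  (forall uex u r : gridfun R N,
     is_solution betax betay eps f uex -> u \in D0 R N ->
     is_residual betax betay eps f u r ->
     mu^-1 * nablanorm r <= nablanorm (u - uex) /\
     nablanorm (u - uex) <= alpha^-1 * nablanorm r).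
Proof.
split; [|split].
- apply: definite_form_represents_D0; first exact: bform_linear_l.
  + exact: bform_linear_r.
  + exact: dotp_linear_r.
  (* Coercivity with [b(u, u) = 0] forces the gradient norm of [u] to vanish. *)
  move=> u uD b0; apply: nabladotp_eq0 => //; apply/eqP.
  have := hcoercive u uD; rewrite b0 nablanorm_sqr pmulr_rle0 // => le0.
  by rewrite eq_le le0 nabladotp_ge0.
(* Riesz representation of [v] to [b(u, v) - l(v)] by the gradient inner product. *)
- move=> u uD; apply: definite_form_represents_D0.
  + exact: nabladotp_linear_l.
  + exact: nabladotp_linear_r.
  + by move=> k v w; rewrite bform_linear_r /lform dotp_linear_r; ring.
  + by move=> v vD; apply: nabladotp_eq0.
move=> uex u r [uexD uexE] uD [rD rE]; set e := u - uex.
have eD : e \in D0 R N by rewrite rpredB.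
have reE v : v \in D0 R N -> nabladotp r v = bform betax betay eps e v.
  by move=> vD; rewrite rE // -uexE // (scalarB (bform_linear_l _ _ _ v)).
have e0 : 0 <= nablanorm e := sqrtr_ge0 _.
have r0 : 0 <= nablanorm r := sqrtr_ge0 _.
split.
  rewrite ler_pdivrMl //; have [->|rn0] := eqVneq (nablanorm r) 0.
    by rewrite mulr_ge0 // ltW.
  have rgt0 : 0 < nablanorm r by rewrite lt_def rn0.
  (* After multiplication by the norm of [r]: [|r|^2 = b(e, r) <= mu |e| |r|]. *)
  by rewrite -(ler_pM2r rgt0) -expr2 nablanorm_sqr reE // hbounded.
rewrite ler_pdivlMl //; have [->|en0] := eqVneq (nablanorm e) 0.
  by rewrite mulr0.
have egt0 : 0 < nablanorm e by rewrite lt_def en0.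
(* After multiplication by the norm of [e]: [alpha |e|^2 <= b(e, e) = (r, e) <= |r| |e|]. *)
rewrite -(ler_pM2r egt0) -mulrA -expr2 (le_trans (hcoercive e eD)) // -reE //.
apply: Cauchy_Schwarz; [exact: nabladotp_linear_l|exact: nabladotp_linear_r|..].
- exact: nabladotpC.
- exact: nabladotp_ge0.
- exact: nabladotp_eq0.
Qed.
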